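(* Let $\mathbf{x}\in\mathbb{R}^{N_{\mathbf{x}}\times 1}$ be an unknown real valued parameter vector and let $\mathbf{y}\in\mathbb{C}^{N_{\mathbf{y}}\times 1}$ be connected with $\mathbf{x}$ via the linear model $\mathbf{y}=\mathbf{H}\mathbf{x}+\mathbf{n}$ with known $\mathbf{H}\in\mathbb{C}^{N_{\mathbf{y}}\times N_{\mathbf{x}}}$ and zero mean complex noise $\mathbf{n}$. Let $$\widetilde{\mathbf{H}}=\begin{bmatrix}\mathbf{H}\\ \mathbf{H}^*\end{bmatrix}\in\mathbb{C}^{2N_{\mathbf{y}}\times N_{\mathbf{x}}},\qquad \underline{\mathbf{y}}=\begin{bmatrix}\mathbf{y}\\ \mathbf{y}^*\end{bmatrix}\in\mathbb{C}^{2N_{\mathbf{y}}\times 1},$$ and assume that $\begin{bmatrix}\Re\{\mathbf{H}\}\\ \Im\{\mathbf{H}\}\end{bmatrix}\in\mathbb{R}^{2N_{\mathbf{y}}\times N_{\mathbf{x}}}$ has full rank with $2N_{\mathbf{y}}\ge N_{\mathbf{x}}$. Then the widely linear least squares (WLLS) estimator for real valued parameter vectors $\hat{\mathbf{x}}_{\mathrm{LS}}$ is given by $$\hat{\mathbf{x}}_{\mathrm{LS}}=\mathbf{G}_{\mathrm{LS}}\,\underline{\mathbf{y}},\qquad \mathbf{G}_{\mathrm{LS}}=\left(\widetilde{\mathbf{H}}^H\widetilde{\mathbf{H}}\right)^{-1}\widetilde{\mathbf{H}}^H,$$ and this can be simplified to $$\hat{\mathbf{x}}_{\mathrm{LS}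}=\left(\Re\{\mathbf{H}^H\mathbf{H}\}\right)^{-1}\Re\{\mathbf{H}^H\mathbf{y}\}.$$
   Context: Notation: $(\cdot)^T$, $(\cdot)^H$ and $(\cdot)^*$ denote transposition, conjugate transposition and (entrywise) complex conjugation; $\Re\{\cdot\}$ and $\Im\{\cdot\}$ denote (entrywise) real and imaginary parts. WLLS estimator for real valued parameter vectors: for given complex $\mathbf{y}$ and $\mathbf{H}$, it is the minimizer, over real valued vectors $\mathbf{x}\in\mathbb{R}^{N_{\mathbf{x}}\times 1}$, of the least squares cost function $$J(\mathbf{x})=(\mathbf{y}-\mathbf{H}\mathbf{x})^H(\mathbf{y}-\mathbf{H}\mathbf{x}).$$ *)

(* Defs.v *)
(* The complex numbers are R[i], for R : realType. *)
From HB Require Import structures.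
From mathcomp Require Import all_boot all_order all_algebra.
From mathcomp Require Import complex.
From mathcomp Require Import all_classical all_reals all_analysis.

Set Implicit Arguments.
Unset Strict Implicit.
Unset Printing Implicit Defensive.

Import Order.TTheory GRing.Theory Num.Theory.

Local Open Scope ring_scope.
Local Open Scope sesquilinear_scope.

Definition mxRe (R : realType) m n (A : 'M[R[i]]_(m, n)) : 'M[R]_(m, n) :=
  map_mx (@complex.Re R) A.

Definition mxIm (R : realType) m n (A : 'M[R[i]]_(m, n)) : 'M[R]_(m, n) :=
  map_mx (@complex.Im R) A.

Definition mxC (R : realType) m n (A : 'M[R]_(m, n)) : 'M[R[i]]_(m, n) :=
  map_mx (real_complex R) A.

Definition augment (R : realType) m n (A : 'M[R[i]]_(m, n)) :
    'M[R[i]]_(m + m, n) :=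
  col_mx A (map_mx Num.conj A).

(* The cost is a 1 x 1 matrix, read as its only entry. *)
Definition ls_cost (R : realType) m n (H : 'M[R[i]]_(m, n)) (y : 'cV[R[i]]_m)
    (x : 'cV[R]_n) : R[i] :=
  ((y - H *m mxC x)^t* *m (y - H *m mxC x)) 0 0.

(* The order of R[i] is partial: a <= b means that b - a is a nonnegative
   real.  It is total on the values of the cost, which are real. *)
Definition ls_minimizer (R : realType) m n (H : 'M[R[i]]_(m, n))
    (y : 'cV[R[i]]_m) (xhat : 'cV[R]_n) : Prop :=
  forall x : 'cV[R]_n, ls_cost H y xhat <= ls_cost H y x.

Definition is_WLLS (R : realType) m n (H : 'M[R[i]]_(m, n))
    (y : 'cV[R[i]]_m) (xhat : 'cV[R]_n) : Prop :=
  unique (ls_minimizer H y) xhat.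

(* Integrability includes measurability of the real and imaginary parts. *)
Definition zero_mean (d : measure_display) (T : measurableType d)
    (R : realType) (P : probability T R) m (n : T -> 'cV[R[i]]_m) : Prop :=
  forall k : 'I_m,
    [/\ P.-integrable [set: T] (fun w => (mxRe (n w) k 0)%:E),
        P.-integrable [set: T] (fun w => (mxIm (n w) k 0)%:E),
        ('E_P[fun w => mxRe (n w) k 0%R] = 0)%E
      & ('E_P[fun w => mxIm (n w) k 0%R] = 0)%E].

Definition G_LS (R : realType) m n (H : 'M[R[i]]_(m, n)) :
    'M[R[i]]_(n, m + m) :=
  invmx ((augment H)^t* *m augment H) *m (augment H)^t*.

(* Main.v *)
Require Import Defs.
From HB Require Import structures.
From mathcomp Require Import all_boot all_order all_algebra.
From mathcomp Require Import complex.
From mathcomp Require Import ring.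
From mathcomp Require Import all_classical all_reals all_analysis.

Set Implicit Arguments.
Unset Strict Implicit.
Unset Printing Implicit Defensive.

Import Order.TTheory GRing.Theory Num.Theory.

Local Open Scope ring_scope.
Local Open Scope sesquilinear_scope.

(** The complex problem is a real one in disguise.  Identify C^m with R^(2m) by
    stacking real and imaginary parts ([stack]).  Since x is real, the residual
    y - Hx becomes b - Sx, with S = [stack H] and b = [stack y], and the cost
    becomes its squared Euclidean norm ([ls_cost_stack]).  The full rank
    assumption says that S has independent columns, hence S^T S is invertible
    ([gram_unitmx]) and Pythagoras' identity makes (S^T S)^-1 S^T b the unique
    minimizer ([real_least_squares]).

    Both formulas of the theorem are this same vector.  Indeed
    S^T S = Re (H^H H) and S^T b = Re (H^H y) ([mxRe_adjmul]), whereas augmenting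
    by the conjugate adds to each product its own conjugate, so that the Gram
    matrix and the right-hand side are both exactly twice these real parts
    ([augment_adjmul]); the factors 2 cancel in G_LS y. *)

Definition sqnorm (F : realFieldType) p (v : 'cV[F]_p) : F := (v^T *m v) 0 0.

Lemma sqnormE (F : realFieldType) p (v : 'cV[F]_p) :
  sqnorm v = \sum_i v i 0 ^+ 2.
Proof. by rewrite /sqnorm mxE; apply: eq_bigr => i _; rewrite mxE -expr2. Qed.

Lemma sqnorm_ge0 (F : realFieldType) p (v : 'cV[F]_p) : 0 <= sqnorm v.
Proof. by rewrite sqnormE sumr_ge0 // => i _; exact: sqr_ge0. Qed.

Lemma sqnorm_eq0 (F : realFieldType) p (v : 'cV[F]_p) : sqnorm v = 0 -> v = 0.
Proof.
rewrite sqnormE => /psumr_eq0P v0; apply/colP => i; rewrite [RHS]mxE.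
by apply/eqP; rewrite -sqrf_eq0 v0 // => j _; exact: sqr_ge0.
Qed.

(** A kernel vector v of S^T S satisfies |S v|^2 = v^T S^T S v = 0. *)
Lemma gram_unitmx (F : realFieldType) p n (S : 'M[F]_(p, n)) :
  \rank S = n -> S^T *m S \in unitmx.
Proof.
move=> rkS; rewrite -row_free_unit; apply: inj_row_free => v vG0.
have fS : row_free S^T by rewrite /row_free mxrank_tr rkS.
have /sqnorm_eq0 Sv0 : sqnorm (S *m v^T) = 0.
  by rewrite /sqnorm trmx_mul trmxK mulmxA -(mulmxA v) vG0 mul0mx mxE.
by apply/eqP; rewrite -(mulmx_free_eq0 v fS) -trmx_eq0 trmx_mul trmxK Sv0.
Qed.

(** The residual of x is r + S (xh - x), with r the residual of xh; when r is
    orthogonal to the columns of S, Pythagoras applies. *)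
Lemma sqnorm_residual (F : realFieldType) p n (S : 'M[F]_(p, n)) (b : 'cV[F]_p)
    (xh x : 'cV[F]_n) :
  S^T *m (b - S *m xh) = 0 ->
  sqnorm (b - S *m x) = sqnorm (b - S *m xh) + sqnorm (S *m (xh - x)).
Proof.
move=> ortho; set r := b - S *m xh in ortho *; set u := S *m (xh - x).
have -> : b - S *m x = r + u by rewrite /r /u mulmxBr addrA subrK.
have ur : u^T *m r = 0 by rewrite trmx_mul -mulmxA ortho mulmx0.
have ru : r^T *m u = 0 by rewrite -[LHS]trmxK trmx_mul trmxK ur trmx0.
have rDu : (r + u)^T = r^T + u^T by rewrite raddfD.
by rewrite /sqnorm rDu mulmxDl (mulmxDr r^T) (mulmxDr u^T) ur ru addr0 add0r mxE.
Qed.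

(** The candidate solves the normal equations S^T (b - S xh) = 0, so the excess
    cost of x is |S (xh - x)|^2; when it vanishes, so does xh - x, because S^T S
    is invertible. *)
Lemma real_least_squares (F : realFieldType) p n (S : 'M[F]_(p, n))
    (b : 'cV[F]_p) :
  S^T *m S \in unitmx ->
  unique (fun xh => forall x, sqnorm (b - S *m xh) <= sqnorm (b - S *m x))
    (invmx (S^T *m S) *m (S^T *m b)).
Proof.
move=> Gu; set xh := invmx _ *m _.
have ortho : S^T *m (b - S *m xh) = 0.
  by rewrite mulmxBr mulmxA mulKVmx ?subrr.
split=> [x|x /(_ xh)]; first by rewrite (sqnorm_residual x ortho) lerDl sqnorm_ge0.
rewrite (sqnorm_residual x ortho) gerDl => le0.
have /sqnorm_eq0 Su0 : sqnorm (S *m (xh - x)) = 0.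
  by apply/eqP; rewrite eq_le le0 sqnorm_ge0.
apply/eqP; rewrite -subr_eq0; apply/eqP.
by rewrite -(mulKmx Gu (xh - x)) -mulmxA Su0 !mulmx0.
Qed.

Definition stack (R : realType) m n (Z : 'M[R[i]]_(m, n)) : 'M[R]_(m + m, n) :=
  col_mx (mxRe Z) (mxIm Z).

Lemma stackB (R : realType) m n (Z W : 'M[R[i]]_(m, n)) :
  stack (Z - W) = stack Z - stack W.
Proof.
rewrite /stack opp_col_mx add_col_mx; congr col_mx;
  by apply/matrixP => i j; rewrite !mxE raddfB.
Qed.

Lemma stack_mul_real (R : realType) m n p (H : 'M[R[i]]_(m, n))
    (X : 'M[R]_(n, p)) :
  stack (H *m mxC X) = stack H *m X.
Proof.
rewrite /stack mul_col_mx; congr col_mx; apply/matrixP => i j;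
  rewrite !mxE raddf_sum; apply: eq_bigr => k _; rewrite !mxE;
  by case: (H i k) => a b /=; rewrite ?mulr0 ?subr0 ?add0r.
Qed.

(** Entrywise, Re (z^* w) = Re z Re w + Im z Im w. *)
Lemma mxRe_adjmul (R : realType) m n p (Z : 'M[R[i]]_(m, n))
    (W : 'M[R[i]]_(m, p)) :
  mxRe (Z^t* *m W) = (stack Z)^T *m stack W.
Proof.
rewrite /stack tr_col_mx mul_row_col; apply/matrixP => i j.
rewrite !mxE raddf_sum -big_split /=; apply: eq_bigr => k _; rewrite !mxE.
by case: (Z k i) (W k j) => [a b] [c e] /=; rewrite mulNr opprK.
Qed.

(** Each entry is a sum of terms z^* w + z w^* = 2 Re (z^* w). *)
Lemma augment_adjmul (R : realType) m n p (Z : 'M[R[i]]_(m, n))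
    (W : 'M[R[i]]_(m, p)) :
  (augment Z)^t* *m augment W = 2 *: mxC (mxRe (Z^t* *m W)).
Proof.
rewrite /augment tr_col_mx map_row_mx mul_row_col; apply/matrixP => i j.
rewrite !mxE -big_split /= raddf_sum rmorph_sum mulr_sumr.
apply: eq_bigr => k _; rewrite !mxE conjCK.
case: (Z k i) (W k j) => [a b] [c e]; apply/eqP.
rewrite eq_complex /=; apply/andP; split; apply/eqP; ring.
Qed.

(** The cost is a sum of terms e^* e = |e|^2, so it is real and equals the
    embedding of its real part, which [mxRe_adjmul] computes. *)
Lemma ls_cost_stack (R : realType) m n (H : 'M[R[i]]_(m, n)) (y : 'cV[R[i]]_m)
    (x : 'cV[R]_n) :
  ls_cost H y x = real_complex R (sqnorm (stack y - stack H *m x)).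
Proof.
rewrite -stack_mul_real -stackB /ls_cost; set e := y - _.
rewrite /sqnorm -mxRe_adjmul [in RHS]mxE [RHS]RRe_real //.
by rewrite mxE rpred_sum // => k _; rewrite !mxE mulrC -normCK realX ?normr_real.
Qed.

(** The factor 2 of [augment_adjmul] is a unit, and a real matrix is invertible
    over R exactly when it is over C. *)
Lemma augment_gram_unitmx (R : realType) m n (H : 'M[R[i]]_(m, n)) :
  mxRe (H^t* *m H) \in unitmx -> (augment H)^t* *m augment H \in unitmx.
Proof.
by move=> Gu; rewrite augment_adjmul unitmxZ ?unitfE ?pnatr_eq0 // map_unitmx.
Qed.

(** The right-hand side is the solution of the real normal equations; doubling
    both sides of these gives the normal equations of the augmented system. *)
Lemma G_LS_augment (R : realType) m n (H : 'M[R[i]]_(m, n)) (y : 'cV[R[i]]_m) :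
  mxRe (H^t* *m H) \in unitmx ->
  G_LS H *m augment y =
    mxC (invmx (mxRe (H^t* *m H)) *m mxRe (H^t* *m y)).
Proof.
move=> Gu; rewrite /G_LS -mulmxA -[RHS](mulKmx (augment_gram_unitmx Gu)).
by rewrite !augment_adjmul -scalemxAl -map_mxM mulKVmx.
Qed.

Theorem mainTheorem2 (R : realType) (d : measure_display)
    (T : measurableType d) (P : probability T R) (Nx Ny : nat)
    (H : 'M[R[i]]_(Ny, Nx)) (x : 'cV[R]_Nx)
    (n y : T -> 'cV[R[i]]_Ny)
    (n_zero_mean : zero_mean P n)
    (linear_model : forall w : T, y w = H *m mxC x + n w)
    (dim_le : (Nx <= 2 * Ny)%N)
    (full_rank : \rank (col_mx (mxRe H) (mxIm H)) = minn (2 * Ny) Nx) :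
  [/\ (augment H)^t* *m augment H \in unitmx,
      mxRe (H^t* *m H) \in unitmx
    & forall w : T, exists xhat : 'cV[R]_Nx,
        [/\ is_WLLS H (y w) xhat,
            mxC xhat = G_LS H *m augment (y w)
          & xhat = invmx (mxRe (H^t* *m H)) *m mxRe (H^t* *m y w)]].
Proof.
have rkS : \rank (stack H) = Nx by rewrite full_rank; apply/minn_idPr.
have Gu : mxRe (H^t* *m H) \in unitmx by rewrite mxRe_adjmul gram_unitmx.
split=> // [|w]; first exact: augment_gram_unitmx.
exists (invmx (mxRe (H^t* *m H)) *m mxRe (H^t* *m y w)); split=> //; last first.
  by rewrite G_LS_augment.
rewrite !mxRe_adjmul; rewrite mxRe_adjmul in Gu.
have [min_xh uniq_xh] := real_least_squares (stack (y w)) Gu.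
split=> [x'|x' min_x']; first by rewrite !ls_cost_stack lecR.
by apply: uniq_xh => x''; rewrite -lecR -!ls_cost_stack.
Qed.
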